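(* Let $N$ be a fixed positive integer. Let $D_1, D_2, \dots$ be an infinite sequence of graphic sequences such that no entry of any $D_i$ exceeds $N$. Then there exist indices $i < j$ such that $D_i \leq D_j$.
   Context: All graphs are finite and simple (neither loops nor multiple edges). An integer sequence $D = (d_1, d_2, \dots, d_n)$ with $d_1 \geq d_2 \geq \dots \geq d_n \geq 1$ is called graphic if there exists a graph $G$ whose degree sequence (the list of its vertex degrees in non-increasing order) is $D$; such a $G$ is called a realization of $D$. For graphic sequences $D$ and $D'$, write $D \leq D'$ to mean that there exist graphs $G$ and $G'$ such that $G$ is a realization of $D$, $G'$ is a realization of $D'$, and $G$ is an induced subgraph of $G'$. *)

(* Defs.v *)
From mathcomp Require Import all_boot.
Set Implicit Arguments.
Unset Strict Implicit.
Unset Printing Implicit Defensive.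

Record sgraph := SGraph {
  vertex :> finType;
  adj : rel vertex;
  adj_sym : symmetric adj;
  adj_irr : irreflexive adj }.

Definition deg (G : sgraph) (x : G) : nat := #|[set y : G | adj x y]|.

Definition degree_sequence (G : sgraph) : seq nat :=
  sort geq [seq deg x | x : G].

Definition realization (G : sgraph) (D : seq nat) : Prop :=
  degree_sequence G = D.

(* The empty sequence, realized by the graph with no vertex, is not excluded. *)
Definition graphic (D : seq nat) : Prop :=
  [/\ sorted geq D, all (leq 1) D & exists G : sgraph, realization G D].

Section Induced.
Variables (G : sgraph) (S : {set G}).

Definition induced_adj : rel {x : G | x \in S} :=
  [rel x y | adj (val x) (val y)].

Lemma induced_adj_sym : symmetric induced_adj.
Proof. by move=> x y; apply: adj_sym. Qed.

Lemma induced_adj_irr : irreflexive induced_adj.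
Proof. by move=> x; apply: adj_irr. Qed.

Definition induced : sgraph := SGraph induced_adj_sym induced_adj_irr.

End Induced.

Definition isomorphic (G H : sgraph) : Prop :=
  exists2 f : G -> H, bijective f & {mono f : x y / adj x y}.

(* Graphs live on distinct vertex types, so being an induced subgraph is
   understood up to isomorphism. *)
Definition induced_subgraph (G G' : sgraph) : Prop :=
  exists S : {set G'}, isomorphic G (induced S).

Definition graphic_le (D D' : seq nat) : Prop :=
  exists G G' : sgraph,
    [/\ realization G D, realization G' D' & induced_subgraph G G'].

(* Main.v *)
Require Import Defs.
From mathcomp Require Import all_boot.
From Stdlib Require Import Classical.

(** A sequence with entries at most [N] is determined by the multiplicities of
    the degrees [0, ..., N], a vector of naturals.  Dickson's lemma yields
    [i < j] such that the vector of [D i] lies below that of [D j]; refining it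
    by residues, the two multiplicities of each degree [d] can also be made
    congruent modulo [d + 1] ([dickson_mod]).  The entries of [D j] that remain
    once those of [D i] are removed then consist of a multiple of [d + 1] copies
    of [d] for every [d], which is the degree sequence of a disjoint union of
    complete graphs [K_(d+1)] ([realizable_dvd_count]).  Adding these complete
    graphs to any realization of [D i] gives a realization of [D j] in which the
    former is a union of components, hence an induced subgraph.

    Dickson's lemma alone would not suffice: the remaining entries would be a
    sequence of even sum, which need not be graphic. *)

Set Implicit Arguments.
Unset Strict Implicit.
Unset Printing Implicit Defensive.

(** * Dickson's lemma with residues *)

(** Subsequences are represented by infinite sets of indices, so that extracting
    one requires no choice of an enumeration. *)
Definition infinite (S : nat -> Prop) := forall n, exists2 m, n <= m & S m.

Lemma exists_argmin (f : nat -> nat) (S : nat -> Prop) :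
  (exists n, S n) -> exists2 m, S m & forall p, S p -> f m <= f p.
Proof.
case=> n; elim/ltn_ind: {n}(f n) {-2}n (erefl (f n)) => v IHv n fn Sn.
have [[p Sp lt_pn] | nolt] := classic (exists2 p, S p & f p < f n).
  by apply: (IHv (f p)) Sp => //; rewrite -fn.
exists n => // p Sp; rewrite leqNgt; apply/negP => lt_pn.
by apply: nolt; exists p.
Qed.

(** The indices of [S] at which [f] is minimal among all later values form the
    required set; a minimum of [f] on a tail of [S] provides one beyond any
    bound. *)
Lemma infinite_nondecreasing (f : nat -> nat) (S : nat -> Prop) :
    infinite S ->
  exists T : nat -> Prop,
    [/\ infinite T, forall n, T n -> S n &
        forall n m, T n -> T m -> n <= m -> f n <= f m].
Proof.
move=> infS.
exists (fun n => S n /\ forall m, S m -> n <= m -> f n <= f m).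
split=> [n | n [] // | n m [_ minn] [Sm _]]; last exact: minn.
have [|m [Sm le_nm] minm] := @exists_argmin f (fun m => S m /\ n <= m).
  by have [m le_nm Sm] := infS n; exists m.
exists m => //; split=> // p Sp le_mp; apply: minm; split=> //.
exact: leq_trans le_mp.
Qed.

(** Constancy of the residue is two monotonicity conditions: the residue and
    its complement to the modulus are both nondecreasing. *)
Lemma infinite_nondecreasing_mod (f : nat -> nat) (k : nat) (S : nat -> Prop) :
    infinite S ->
  exists T : nat -> Prop,
    [/\ infinite T, forall n, T n -> S n &
        forall n m, T n -> T m -> n <= m ->
          f n <= f m /\ f n = f m %[mod k.+1]].
Proof.
move=> infS.
have [T1 [infT1 sub1 mon1]] := infinite_nondecreasing f infS.
have [T2 [infT2 sub2 mon2]] :=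
  infinite_nondecreasing (fun n => f n %% k.+1) infT1.
have [T3 [infT3 sub3 mon3]] :=
  infinite_nondecreasing (fun n => k.+1 - f n %% k.+1) infT2.
exists T3; split=> // [n /sub3/sub2/sub1 // | n m Tn Tm le_nm].
split; first by apply: mon1 => //; apply/sub2/sub3.
apply/eqP; rewrite eqn_leq mon2 //=; try exact: sub3.
by have := mon3 _ _ Tn Tm le_nm; rewrite leq_sub2lE // ltnW // ltn_mod.
Qed.

Lemma dickson_mod (F : nat -> nat -> nat) (K : nat) :
  exists i j, i < j /\
    forall d, d < K -> F d i <= F d j /\ F d i = F d j %[mod d.+1].
Proof.
suff [T [infT monT]] : exists T : nat -> Prop, infinite T /\
    forall n m, T n -> T m -> n <= m -> forall d, d < K ->
      F d n <= F d m /\ F d n = F d m %[mod d.+1].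
  have [i _ Ti] := infT 0; have [j lt_ij Tj] := infT i.+1.
  by exists i, j; split=> // d; apply: monT => //; apply: ltnW.
elim: K => [|K [S [infS monS]]].
  by exists (fun=> True); split=> // n; exists n.
have [T [infT subT monT]] := infinite_nondecreasing_mod (F K) K infS.
exists T; split=> // n m Tn Tm le_nm d; rewrite ltnS leq_eqVlt.
by case/predU1P=> [-> | ltdK]; [apply: monT | apply: monS => //; apply: subT].
Qed.

(** * Disjoint unions and complete graphs *)

Section DisjointUnion.
Variables G H : sgraph.

Definition union_adj : rel (G + H) := fun u v =>
  match u, v with
  | inl x, inl y => adj x y
  | inr x, inr y => adj x y
  | _, _ => false
  end.

Lemma union_adj_sym : symmetric union_adj.
Proof. by move=> [x|x] [y|y] //=; apply: adj_sym. Qed.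

Lemma union_adj_irr : irreflexive union_adj.
Proof. by case=> x /=; apply: adj_irr. Qed.

Definition disjoint_union : sgraph := SGraph union_adj_sym union_adj_irr.

Lemma deg_inl (x : G) : @deg disjoint_union (inl x) = deg x.
Proof.
rewrite /deg -(card_imset _ (@inl_inj G H)); apply: eq_card => -[y|y].
  by rewrite inE mem_imset ?inE //; apply: inl_inj.
by rewrite inE; apply/esym/negP => /imsetP[].
Qed.

Lemma deg_inr (x : H) : @deg disjoint_union (inr x) = deg x.
Proof.
rewrite /deg -(card_imset _ (@inr_inj G H)); apply: eq_card => -[y|y].
  by rewrite inE; apply/esym/negP => /imsetP[].
by rewrite inE mem_imset ?inE //; apply: inr_inj.
Qed.

Lemma degrees_disjoint_union :
  [seq deg x | x : disjoint_union] =
  [seq deg x | x : G] ++ [seq deg x | x : H].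
Proof.
rewrite /image_mem !enumT [in LHS]unlock /= /sum_enum map_cat -!map_comp.
by congr (_ ++ _); apply: eq_map => x /=; rewrite (deg_inl, deg_inr).
Qed.

Lemma induced_subgraph_union : induced_subgraph G disjoint_union.
Proof.
pose S : {set disjoint_union} := [set inl x | x : G].
have inS x : inl x \in S by apply: imset_f.
exists S, (fun x => exist _ (inl x) (inS x)) => //.
apply: inj_card_bij => [x y [] // | ].
by rewrite card_sig card_imset //; apply: inl_inj.
Qed.

End DisjointUnion.

Section Complete.
Variable T : finType.

Definition complete_adj : rel T := fun x y => x != y.

Lemma complete_adj_sym : symmetric complete_adj.
Proof. by move=> x y; rewrite /complete_adj eq_sym. Qed.

Lemma complete_adj_irr : irreflexive complete_adj.
Proof. by move=> x; rewrite /complete_adj eqxx. Qed.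

Definition complete : sgraph := SGraph complete_adj_sym complete_adj_irr.

Lemma degrees_complete : [seq deg x | x : complete] = nseq #|T| #|T|.-1.
Proof.
rewrite -[X in nseq X](size_image (@deg complete) T); apply/all_pred1P/allP.
move=> _ /imageP[x _ ->] /=; apply/eqP.
rewrite /deg (cardD1 x T) inE /=; apply: eq_card => y.
by rewrite !inE /= /complete_adj eq_sym andbT.
Qed.

End Complete.

(** * Degree multisets realized by complete graphs *)

(** Degrees are compared up to permutation, and zeros are allowed, so that
    realizability is preserved by concatenation with no need to sort. *)
Definition realizable (s : seq nat) :=
  exists G : sgraph, perm_eq [seq deg x | x : G] s.

Lemma realizable_cat s t : realizable s -> realizable t -> realizable (s ++ t).
Proof.
move=> [G Gs] [H Ht]; exists (disjoint_union G H).
by rewrite degrees_disjoint_union perm_cat.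
Qed.

Lemma realizable_nil : realizable [::].
Proof. by exists (complete 'I_0); rewrite degrees_complete card_ord. Qed.

(** The witness is [k] disjoint copies of the complete graph on [d + 1]
    vertices. *)
Lemma realizable_nseq k d : realizable (nseq (k * d.+1) d).
Proof.
elim: k => [|k IHk]; first exact: realizable_nil.
rewrite mulSn nseqD; apply: realizable_cat => //.
by exists (complete 'I_d.+1); rewrite degrees_complete card_ord.
Qed.

(** The occurrences of each value [d] are realized on their own by copies of
    [K_(d+1)]; the induction strips all occurrences of one value at a time,
    which leaves the other multiplicities unchanged. *)
Lemma realizable_dvd_count (s : seq nat) :
  (forall d, d.+1 %| count_mem d s) -> realizable s.
Proof.
elim/ltn_ind: {s}(size s) {-2}s (leqnn (size s)) => n IHn [|d s] sz_s dvd_s.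
  exact: realizable_nil.
set t := d :: s in sz_s dvd_s *.
have cnt_t : filter (pred1 d) t = nseq (count_mem d t) d.
  by rewrite -size_filter; apply/all_pred1P; apply: filter_all.
have [G Gt] : realizable (filter (pred1 d) t ++ filter (predC (pred1 d)) t).
  apply: realizable_cat.
    by rewrite cnt_t; case/dvdnP: (dvd_s d) => k ->; apply: realizable_nseq.
  apply: (IHn (size (filter (predC (pred1 d)) t))) => // [|e].
    apply: leq_trans sz_s; rewrite size_filter /t /= eqxx /= ltnS.
    exact: count_size.
  rewrite count_filter; have [->|ne_ed] := eqVneq e d.
    by rewrite (eq_count (a2 := pred0)) ?count_pred0 // => x /=; case: eqP.
  rewrite (eq_count (a2 := pred1 e)) ?dvd_s // => x /=.
  by case: (x =P e) => [->|].
by exists G; rewrite (perm_trans Gt) // perm_filterC.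
Qed.

Lemma count_complement (T : eqType) (s t : seq T) :
    (forall x, count_mem x s <= count_mem x t) ->
  exists e, perm_eq t (s ++ e).
Proof.
elim: s t => [|x s IHs] t le_st; first by exists t.
have tx : x \in t.
  by rewrite -has_pred1 has_count (leq_trans _ (le_st x)) //= eqxx.
have tE := perm_to_rem tx.
have [y|e te] := IHs (rem x t); last first.
  by exists e; rewrite (perm_trans tE) //= perm_cons.
by have := le_st y; rewrite (permP tE) /= leq_add2l.
Qed.

Theorem theorem3 (N : nat) (hN : 0 < N) (D : nat -> seq nat)
    (hD : forall i, graphic (D i))
    (hbound : forall i d, d \in D i -> d <= N) :
  exists i j : nat, i < j /\ graphic_le (D i) (D j).
Proof.
have [i [j [lt_ij mon]]] := dickson_mod (fun d i => count_mem d (D i)) N.+1.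
exists i, j; split=> //.
(* The bound [d < N.+1] is removed: larger degrees never occur. *)
have le_mod d : count_mem d (D i) <= count_mem d (D j) /\
    count_mem d (D i) = count_mem d (D j) %[mod d.+1].
  have [/mon //|lt_Nd] := ltnP d N.+1.
  have cnt0 k : count_mem d (D k) = 0.
    by apply/count_memPn/negP => /hbound; rewrite leqNgt lt_Nd.
  by rewrite !cnt0.
have [e Dj] : exists e, perm_eq (D j) (D i ++ e).
  by apply: count_complement => d; case: (le_mod d).
have [d|H He] := @realizable_dvd_count e.
  have [_ /esym/eqP] := le_mod d.
  rewrite (permP Dj) count_cat eqn_mod_dvd ?leq_addr //.
  by rewrite addKn.
have [_ _ [G GDi]] := hD i; have [sDj _ _] := hD j.
exists G, (disjoint_union G H); split=> //; last exact: induced_subgraph_union.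
have geq_total : total geq by move=> x y; apply: leq_total.
have geq_trans : transitive geq by move=> x y z /= yx zy; apply: leq_trans yx.
have geq_anti : antisymmetric geq.
  by move=> x y; rewrite andbC => /anti_leq.
apply: (sorted_eq geq_trans geq_anti) => //; first exact: sort_sorted.
rewrite perm_sort degrees_disjoint_union perm_sym (perm_trans Dj) //.
apply: perm_cat; last by rewrite perm_sym.
by rewrite -[D i]GDi perm_sort.
Qed.
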